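(* Let $0 < a < 1$, $0 < b < 1$ with $b \leq 2a$, and let $p_*(a,b,1) = (4 - 4a + 2b)/b$. Then for every $p_0 < p_*(a,b,1)$ there exist a Borel probability measure $\mu$ on $\mathbb{R}$ and a $p \geq p_0$ such that: (A) there is a constant $C>0$ with $\mu(B(x,r)) \leq C r^{a}$ for all $x \in \mathbb{R}$ and all $r > 0$; (B) there is a constant $C>0$ with $|\mathcal{F}(\mu)(\xi)| \leq C(1+|\xi|)^{-b/2}$ for all $\xi \in \mathbb{R}$; and the following statement is false: there is a constant $C > 0$ such that $\|\mathcal{F}(f\mu)\|_{L^p(\lambda)} \leq C \|f\|_{L^2(\mu)}$ for all $f \in L^2(\mu)$.
   Context: $B(x,r)$ is the open interval with center $x$ and radius $r$. For a finite (complex) measure $\nu$ on $\mathbb{R}$, $\mathcal{F}(\nu)(\xi) = \int_{\mathbb{R}} e^{-2\pi i x \xi}\, d\nu(x)$. $\lambda$ is Lebesgue measure on $\mathbb{R}$, and $f\mu$ is the measure with density $f$ with respect to $\mu$. *)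

(* Defs.v *)
From HB Require Import structures.
From mathcomp Require Import all_boot all_order all_algebra complex.
From mathcomp Require Import all_classical all_reals all_analysis.

Set Implicit Arguments.
Unset Strict Implicit.
Unset Printing Implicit Defensive.

Import Order.TTheory GRing.Theory Num.Theory.
Import numFieldNormedType.Exports.

Local Open Scope classical_set_scope.
Local Open Scope ring_scope.
Local Open Scope complex_scope.

(* The real-valued modulus; the ring_scope norm on [R[i]] takes values
   in [R[i]]. *)
Definition cmod (R : realType) (z : R[i]) : R := ComplexField.Normc.normc z.

(* exp(i t) *)
Definition cexpi (R : realType) (t : R) : R[i] := cos t +i* sin t.

Definition cmeasurable d (T : measurableType d) (R : realType)
    (f : T -> R[i]) : Prop :=
  measurable_fun setT (fun x => complex.Re (f x)) /\
  measurable_fun setT (fun x => complex.Im (f x)).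

(* Meaningful when the real and imaginary parts of [g] are integrable. *)
Definition cintegral d (T : measurableType d) (R : realType)
    (mu : {measure set T -> \bar R}) (g : T -> R[i]) : R[i] :=
  (\int[mu]_x complex.Re (g x)) +i* (\int[mu]_x complex.Im (g x)).

(* The L^p norm of a complex-valued function is that of its modulus. *)
Definition cLnorm d (T : measurableType d) (R : realType)
    (mu : {measure set T -> \bar R}) (p : R) (f : T -> R[i]) : \bar R :=
  ('N[mu]_(p%:E)[EFin \o (fun x => cmod (f x))])%E.

Definition cLfun d (T : measurableType d) (R : realType)
    (mu : {measure set T -> \bar R}) (p : R) (f : T -> R[i]) : Prop :=
  cmeasurable f /\ (cLnorm mu p f < +oo)%E.

Definition fourier (R : realType)
    (mu : {measure set (measurableTypeR R) -> \bar R}) (xi : R) : R[i] :=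
  cintegral mu (fun x : measurableTypeR R => cexpi (- (2 * pi * x * xi))).

(* The Fourier transform of the complex measure with density [f] with respect
   to [mu]: integration against that measure is integration of the product
   with [f] against [mu].  For [f] in L^2 and [mu] finite, the integrand is
   integrable. *)
Definition fourier_density (R : realType)
    (mu : {measure set (measurableTypeR R) -> \bar R})
    (f : measurableTypeR R -> R[i]) (xi : R) : R[i] :=
  cintegral mu
    (fun x : measurableTypeR R => cexpi (- (2 * pi * x * xi)) * f x).

(* Main.v *)
Require Import Defs.
From mathcomp Require Import all_boot all_order all_algebra complex.
From mathcomp Require Import all_classical all_reals all_analysis.
From mathcomp Require Import measurable_realfun ring lra.
Import Order.TTheory GRing.Theory Num.Theory.
Import numFieldNormedType.Exports.
Local Open Scope classical_set_scope.
Local Open Scope ring_scope.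

(** The measure is absolutely continuous, and each of its pieces is as
singular as the two required bounds permit at a single scale.

Fix a large t, put c = a - b/2 (which lies in [0, 1) since b <= 2a and a < 1)
and pick integers N ~ t^c and M ~ t^(1-c).  A packet is the uniform
probability on N intervals (teeth) of length d = 1/(16 N M) ~ 1/t that start at
the multiples of 1/N.  With the weight w = t^(-b/2), three facts hold, with
constants that do not depend on t.

- Ball condition.  The weighted packet has density w/(N d) ~ t^(1-a), which
  settles radii r <= 1/t.  For 1/t <= r <= 1 a ball meets
  O(r N + 1) teeth, each of mass w/N ~ t^(-a) <= r^a, and r w <= r <= r^a
  [weighted_packet_ball].
- Fourier decay.  The transform of a packet is at most of size
  min(1, 1/(d |xi|)), and w is exactly what turns this into |xi|^(-b/2)
  [weighted_packet_1Dcos].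
- Knapp-type obstruction.  For x in a tooth and xi within 1/16 above l N with
  0 <= l < M, the product x xi is within 1/8 of an integer.  Hence the
  transform of the indicator of the teeth times mu has modulus at least cos(1)
  times the mass of the teeth on a set of measure M/16, and a restriction estimate with
  constant C forces
    cos(1)^2 w (M/16)^(2/p) <= C^2,  up to the weight of the packet in mu
  [knapp_lower_bound].

Since w (M/16)^(2/p) ~ t^((1-c) 2/p - b/2), the left side is unbounded in t
exactly when p < (4 - 4a + 2b)/b.  A sum over k of such packets with weights
2^(-k-1), the k-th parameter t being so large that the left side is still at
least cos(1)^2 (k+1), keeps the first two bounds and refutes the estimate for every C at once;
dividing by the total mass gives the probability measure.

Signed integrals are avoided until the very end: decay is recorded as
  int (1 + cos (2 pi xi x + phi)) dm <= m(R) + B  for every phi,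
an inequality between integrals of nonnegative functions, which survives sums,
scalings and series of measures; the phases phi = 0, pi, pi/2, 3pi/2 recover the
bounds on the real and imaginary parts of the transform. *)

(** * Oscillatory integrals over one interval *)

Lemma uniform_probE {R : realType} (a b : R) (ab : a < b)
    (A : set (measurableTypeR R)) : measurable A ->
  uniform_prob ab A = ((b - a)^-1%:E * lebesgue_measure (A `&` `[a, b]))%E.
Proof.
move=> mA.
rewrite /uniform_prob integral_uniform_pdf (eq_integral (fun=> (b - a)^-1%:E)).
  by rewrite integral_cst//; exact: measurableI.
by move=> x; rewrite inE/= in_itv/= /uniform_pdf => -[_ ->].
Qed.

Lemma measurable_cos {R : realType} (g : measurableTypeR R -> R) :
  measurable_fun setT g -> measurable_fun setT (fun x => cos (g x)).
Proof.
move=> mg; apply: measurableT_comp mg.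
by apply: continuous_measurable_fun; exact: continuous_cos.
Qed.

Lemma measurable_1Dcos {R : realType} (th phi : R) :
  measurable_fun [set: measurableTypeR R]
    (fun x : R => (1 + cos (th * x + phi))%:E).
Proof.
apply/measurable_EFinP; apply: measurable_funD => //; apply: measurable_cos.
by apply: measurable_funD => //; exact: measurable_funM.
Qed.

Lemma integral_1Dcos {R : realType} (a b th phi : R) : a < b -> th != 0 ->
  (\int[lebesgue_measure]_(x in `[a, b]) (1 + cos (th * x + phi))%:E =
   (b - a + (sin (th * b + phi) - sin (th * a + phi)) / th)%:E)%E.
Proof.
move=> ab th0.
pose F (x : R) := x + sin (th * x + phi) / th.
have dF (x : R) : is_derive x 1 F (1 + cos (th * x + phi)).
  rewrite /F.
  have e : is_derive x 1 (fun x : R => th * x + phi) th.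
    by apply: is_derive_eq; rewrite /GRing.scale/= mulr1 addr0.
  have e2 := @is_derive1_comp R sin (fun x : R => th * x + phi) x _ _
    (is_derive_sin _) e.
  apply: is_derive_eq. rewrite /GRing.scale/=.
  by field.
have cF : continuous F.
  move=> x; apply/differentiable_continuous/derivable1_diffP.
  exact: ex_derive.
rewrite (@continuous_FTC2 _ _ F)//.
- by rewrite -EFinB /F; congr EFin; field.
- apply: continuous_subspaceT => x.
  apply: cvgD; first exact: cvg_cst.
  apply: (@continuous_comp _ _ _ (fun x : R => th * x + phi)); last first.
    exact: continuous_cos.
  apply: cvgD; last exact: cvg_cst.
  exact: mulrl_continuous.
- split => [x _||].
  + exact: ex_derive.
  + exact: cvg_at_right_filter (cF _).
  + exact: cvg_at_left_filter (cF _).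
- by move=> x _; rewrite derive1E; apply: derive_val.
Qed.

(** The right side encodes 1 + min(1, 1/(d |xi|)) for an interval of length d: the
trivial bound is used when d |xi| <= 1, and otherwise the primitive of the
cosine gains 1/(pi |xi|). *)
Lemma uniform_1Dcos_le {R : realType} (a b xi phi : R) (ab : a < b) :
  (\int[uniform_prob ab]_x (1 + cos (2 * pi * xi * x + phi))%:E <=
   (1 + 2 / (1 + (b - a) * `|xi|))%:E)%E.
Proof.
have d0 : 0 < b - a by rewrite subr_gt0.
have cosp (x : R) : 0 <= 1 + cos (2 * pi * xi * x + phi).
  by rewrite -lerBlDl sub0r cos_geN1.
have D0 : 0 < 1 + (b - a) * `|xi| by rewrite ltr_wpDr// mulr_ge0// ltW.
have [small|big] := leP ((b - a) * `|xi|) 1.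
  apply: (@le_trans _ _ (\int[uniform_prob ab]_x (cst 2%:E) x)%E).
    apply: ge0_le_integral => //.
    - exact: measurable_1Dcos.
    - by move=> x _; rewrite /cst lee_fin (_ : 2 = 1 + 1)// lerD2l cos_le1.
  rewrite integral_cst; last exact: measurableT.
  rewrite [X in (_ * X)%E](probability_setT (uniform_prob ab)) mule1 lee_fin.
  rewrite (_ : 2 = 1 + 1)// lerD2l ler_pdivlMr// mul1r.
  by rewrite lerD2l.
have xi0 : xi != 0 by apply: contraTN big => /eqP->; rewrite normr0 mulr0 -leNgt.
have th0 : 2 * pi * xi != 0 by rewrite !mulf_neq0// gt_eqF// pi_gt0.
rewrite integral_uniform; [|exact: measurable_1Dcos|by move=> x; rewrite lee_fin].
rewrite integral_1Dcos// -EFinM lee_fin mulrDr mulVf ?gt_eqF// lerD2l.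
set s := sin _ - sin _.
have s2 : `|s| <= 2.
  by rewrite (le_trans (ler_normB _ _))// (_ : 2 = 1 + 1)// lerD// sin_max.
have nx0 : 0 < `|xi| by rewrite normr_gt0.
apply: (@le_trans _ _ (((b - a) * `|xi|)^-1)).
  rewrite (le_trans (ler_norm _))// normrM normfV (gtr0_norm d0) [leRHS]invfM ler_wpM2l//.
    by rewrite invr_ge0 ltW.
  rewrite normrM normfV !normrM (gtr0_norm (pi_gt0 R)) normr_nat.
  rewrite ler_pdivrMr ?mulr_gt0// ?pi_gt0//.
  rewrite [leRHS]mulrC mulfK ?gt_eqF// (le_trans s2)//.
  have := pi_ge2 R; lra.
rewrite -[X in X <= _]mul1r ler_pdivrMr; last by rewrite mulr_gt0.
rewrite mulrAC ler_pdivlMr// mul1r; lra.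
Qed.

(** * Packets of equally spaced teeth *)

Lemma progression_itv_lt {R : realType} {d : R} (h : R) (j : nat) :
  0 < d -> j%:R * h < j%:R * h + d.
Proof. by rewrite ltrDl. Qed.

(** The average of the uniform probabilities on the N intervals
[j/N, j/N + d], j < N. *)
Definition packet {R : realType} (N : nat) {d : R} (d0 : 0 < d) :
    {measure set (measurableTypeR R) -> \bar R} :=
  mscale (N%:R^-1)%:nng
    (msum (fun j => uniform_prob (progression_itv_lt N%:R^-1 j d0)) N).

Lemma integral_packet {R : realType} (N : nat) (d : R) (d0 : 0 < d)
    (f : measurableTypeR R -> \bar R) :
  measurable_fun setT f -> (forall x, 0 <= f x)%E ->
  (\int[packet N d0]_x f x = (N%:R^-1)%:E * \sum_(j < N)
     \int[uniform_prob (progression_itv_lt N%:R^-1 j d0)]_x f x)%E.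
Proof.
move=> mf f0; rewrite ge0_integral_mscale//; congr (_ * _)%E.
by rewrite ge0_integral_measure_sum.
Qed.

Lemma packetE {R : realType} (N : nat) (d : R) (d0 : 0 < d)
    (A : set (measurableTypeR R)) :
  packet N d0 A = ((N%:R^-1)%:E *
    \sum_(j < N) uniform_prob (progression_itv_lt N%:R^-1 j d0) A)%E.
Proof. by []. Qed.

Lemma mean_le {R : realType} (N : nat) (F : nat -> \bar R) (B : R) :
  (0 < N)%N -> (forall j, (F j <= B%:E)%E) ->
  ((N%:R^-1)%:E * \sum_(j < N) F j <= B%:E)%E.
Proof.
move=> N0 FB; have NR : 0 < N%:R :> R by rewrite ltr0n.
apply: (@le_trans _ _ ((N%:R^-1)%:E * \sum_(j < N) B%:E)%E).
  by apply: lee_wpmul2l; [rewrite lee_fin invr_ge0 ltW|exact: lee_sum].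
by rewrite sumEFin -EFinM lee_fin sumr_const card_ord -[B *+ N]mulr_natl mulKf ?gt_eqF.
Qed.

Lemma packet_1Dcos_le {R : realType} (N : nat) (d : R) (d0 : 0 < d) (xi phi : R) :
  (0 < N)%N ->
  (\int[packet N d0]_x (1 + cos (2 * pi * xi * x + phi))%:E <=
   (1 + 2 / (1 + d * `|xi|))%:E)%E.
Proof.
move=> N0; rewrite integral_packet//.
- apply: (@mean_le R N (fun j =>
    \int[uniform_prob (progression_itv_lt N%:R^-1 j d0)]_x
      (1 + cos (2 * pi * xi * x + phi))%:E)%E) => // j.
  by rewrite (le_trans (uniform_1Dcos_le _ _ _ _ _))// addrAC subrr add0r.
- exact: measurable_1Dcos.
Qed.

Lemma packet_le1 {R : realType} (N : nat) (d : R) (d0 : 0 < d)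
    (A : set (measurableTypeR R)) :
  (0 < N)%N -> measurable A -> (packet N d0 A <= 1)%E.
Proof.
move=> N0 mA; rewrite packetE.
apply: (@mean_le R N (fun j =>
  uniform_prob (progression_itv_lt N%:R^-1 j d0) A) 1) => // j.
exact: probability_le1.
Qed.

Definition grid_itv {R : realType} (h d : R) (j : nat) :
  set (measurableTypeR R) := `[j%:R * h, j%:R * h + d]%classic.

Definition grid {R : realType} (h d : R) (N : nat) : set (measurableTypeR R) :=
  \big[setU/set0]_(j < N) grid_itv h d j.

Lemma measurable_grid {R : realType} (h d : R) (N : nat) :
  measurable (grid h d N).
Proof. by apply: bigsetU_measurable => j _; exact: measurable_itv. Qed.

Lemma packet_grid {R : realType} (N : nat) (d : R) (d0 : 0 < d) :
  (0 < N)%N -> packet N d0 (grid N%:R^-1 d N) = 1%E.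
Proof.
move=> N0; apply/eqP; rewrite eq_le packet_le1//=; last exact: measurable_grid.
have NR : 0 < N%:R :> R by rewrite ltr0n.
rewrite packetE -[leLHS](_ : (N%:R^-1)%:E * \sum_(j < N) 1%:E = 1)%E; last first.
  by rewrite sumEFin -EFinM sumr_const card_ord mulVf ?gt_eqF.
apply: lee_wpmul2l; first by rewrite lee_fin invr_ge0 ltW.
apply: lee_sum => j _.
rewrite uniform_probE; last exact: measurable_grid.
rewrite setIidr; last first.
  by rewrite /grid (bigD1 j)//=; exact: subsetUl.
rewrite lebesgue_measure_itv/= lte_fin ltrDl d0 -EFinB -EFinM mulVf//.
by rewrite gt_eqF// addrAC subrr add0r.
Qed.

(** The half-open cells tile the line, so any family of sets taken one per cell
is disjoint; both the teeth and the set of good frequencies are of this kind. *)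
Definition cell {R : realType} (h : R) (j : nat) : set (measurableTypeR R) :=
  `[j%:R * h, j.+1%:R * h[%classic.

Lemma trivIset_cell {R : realType} (h : R) : 0 < h -> trivIset setT (cell h).
Proof.
move=> h0; apply/trivIsetP => i j _ _.
wlog ij : i j / (i < j)%N.
  move=> H; rewrite neq_lt => /orP[ij|ji]; first by apply: H; rewrite // lt_eqF.
  by rewrite setIC; apply: H; rewrite // lt_eqF.
move=> _; rewrite -subset0 => x []; rewrite /cell/= !in_itv/= => /andP[_ xi] /andP[jx _].
have : i.+1%:R * h <= j%:R * h by rewrite ler_pM2r// ler_nat.
by move: xi jx; lra.
Qed.

Lemma sum_cell_measure {R : realType} (h : R) (N : nat)
    (A : nat -> set (measurableTypeR R)) : 0 < h ->
  (forall j, measurable (A j)) -> (forall j, A j `<=` cell h j) ->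
  (\sum_(j < N) lebesgue_measure (A j) =
   lebesgue_measure (\big[setU/set0]_(j < N) A j))%E.
Proof.
move=> h0 mA Acell; rewrite measure_bigsetU//.
apply/trivIsetP => i j _ _ ij.
rewrite -subset0 => x [/Acell xi /Acell xj].
by have /trivIsetP/(_ i j I I ij) <- := trivIset_cell _ h0.
Qed.

Lemma grid_itv_sub_cell {R : realType} (h d : R) (j : nat) :
  d < h -> grid_itv h d j `<=` cell h j.
Proof.
move=> dh x; rewrite /grid_itv /cell/= !in_itv/= => /andP[-> xd]/=.
by rewrite (le_lt_trans xd)// -natr1 mulrDl mul1r ltrD2l.
Qed.

Lemma lebesgue_measure_grid {R : realType} (h d : R) (N : nat) :
  0 < d -> d < h -> lebesgue_measure (grid h d N) = (N%:R * d)%:E.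
Proof.
move=> d0 dh; rewrite -(@sum_cell_measure R h) ?(lt_trans d0)//; last 2 first.
  by move=> j; exact: measurable_itv.
  by move=> j; exact: grid_itv_sub_cell.
under eq_bigr.
  move=> j _; rewrite lebesgue_measure_itv/= lte_fin ltrDl d0 -EFinB addrAC subrr add0r.
  over.
by rewrite sumEFin sumr_const card_ord mulr_natl.
Qed.

Lemma uniform_toothE {R : realType} (h d : R) (j : nat) (d0 : 0 < d)
    (A : set (measurableTypeR R)) : measurable A ->
  uniform_prob (progression_itv_lt h j d0) A =
  ((d^-1)%:E * lebesgue_measure (A `&` grid_itv h d j))%E.
Proof. by move=> mA; rewrite uniform_probE// addrAC subrr add0r. Qed.

(** A packet has density at most 1/(N d), as its teeth are disjoint. *)
Lemma packet_ball_small {R : realType} (N : nat) (d : R) (d0 : 0 < d) (x r : R) :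
  (0 < N)%N -> d < N%:R^-1 -> 0 < r ->
  (packet N d0 (ball x r : set (measurableTypeR R)) <= (2 * r / (N%:R * d))%:E)%E.
Proof.
move=> N0 dN r0; have NR : 0 < N%:R :> R by rewrite ltr0n.
pose B := ball x r : set (measurableTypeR R).
have mB : measurable B by exact: measurable_ball.
pose A j : set (measurableTypeR R) := B `&` grid_itv N%:R^-1 d j.
have mA j : measurable (A j) by apply: measurableI => //; exact: measurable_itv.
rewrite packetE.
under eq_bigr do rewrite uniform_toothE//.
rewrite -ge0_sume_distrr; last by move=> j _; exact: measure_ge0.
rewrite (@sum_cell_measure R N%:R^-1 N A) ?invr_gt0//; last first.
  by move=> j y [_ /grid_itv_sub_cell]; exact.
rewrite muleA -EFinM.
have -> : 2 * r / (N%:R * d) = N%:R^-1 / d * (r *+ 2).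
  by rewrite -[r *+ 2]mulr_natl invfM [RHS]mulrC.
rewrite [leRHS]EFinM -(lebesgue_measure_ball x) ?(ltW r0)//; apply: lee_wpmul2l.
  by rewrite lee_fin mulr_ge0// invr_ge0 ltW.
apply: le_measure; rewrite ?inE//; first exact: bigsetU_measurable.
by rewrite -bigcup_mkord => y [j _ []].
Qed.

(** A tooth that meets the ball has its whole cell, of length 1/N, inside the
ball of radius r + 1/N.  So each tooth carries at most N times the length of the
part of its cell in the larger ball, and the cells are disjoint; this replaces
counting teeth. *)
Lemma packet_ball_large {R : realType} (N : nat) (d : R) (d0 : 0 < d) (x r : R) :
  (0 < N)%N -> d < N%:R^-1 -> 0 < r ->
  (packet N d0 (ball x r : set (measurableTypeR R)) <= (2 * r + 2 / N%:R)%:E)%E.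
Proof.
move=> N0 dN r0; have NR : 0 < N%:R :> R by rewrite ltr0n.
have h0 : 0 < N%:R^-1 :> R by rewrite invr_gt0.
pose B := ball x r : set (measurableTypeR R).
pose B' := ball x (r + N%:R^-1) : set (measurableTypeR R).
have mB : measurable B by exact: measurable_ball.
have mB' : measurable B' by exact: measurable_ball.
pose A j : set (measurableTypeR R) := B' `&` cell N%:R^-1 j.
have mA j : measurable (A j) by apply: measurableI => //; exact: measurable_itv.
have key j : (uniform_prob (progression_itv_lt N%:R^-1 j d0) B <=
              N%:R%:E * lebesgue_measure (A j))%E.
  have [hit|miss] := pselect (exists2 y, B y & grid_itv N%:R^-1 d j y).
    have AE : A j = cell N%:R^-1 j.
      rewrite /A setIidr// => z cz; have [y By /(grid_itv_sub_cell _ _ _ dN) cy] := hit.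
      move: By cy cz; rewrite /B /B' !ball_itv /cell/= !in_itv/= -natr1 mulrDl mul1r.
      lra.
    rewrite AE lebesgue_measure_itv/= lte_fin ltr_pM2r// ltr_nat ltnSn -EFinB -EFinM.
    by rewrite -mulrBl -natr1 addrAC subrr add0r mul1r mulfV ?gt_eqF// probability_le1.
  rewrite uniform_toothE// (_ : _ `&` _ = set0) ?measure0 ?mule0; last first.
    by rewrite -subset0 => y [By Iy]; apply: miss; exists y.
  by rewrite mule_ge0// lee_fin.
rewrite packetE.
apply: (@le_trans _ _ ((N%:R^-1)%:E * \sum_(j < N) N%:R%:E * lebesgue_measure (A j))%E).
  by apply: lee_wpmul2l; [rewrite lee_fin ltW|apply: lee_sum].
rewrite -ge0_sume_distrr; last by move=> j _; exact: measure_ge0.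
rewrite (@sum_cell_measure R N%:R^-1 N A)//; last by move=> j y [].
rewrite muleA -EFinM mulVf ?gt_eqF// mul1e.
rewrite -mulrDr mulr_natl -(lebesgue_measure_ball x) ?addr_ge0 ?(ltW r0) ?(ltW h0)//.
apply: le_measure; rewrite ?inE//; first exact: bigsetU_measurable.
by rewrite -bigcup_mkord => y [j _ []].
Qed.

(** * Weighted packets: the ball condition and Fourier decay *)

Definition tooth_width {R : realType} (n m : nat) : R :=
  (16 * n.+1%:R * m.+1%:R)^-1.

Lemma tooth_width_gt0 {R : realType} (n m : nat) : 0 < tooth_width n m :> R.
Proof. by rewrite invr_gt0 !mulr_gt0. Qed.

Lemma tooth_width_lt {R : realType} (n m : nat) : tooth_width n m < n.+1%:R^-1 :> R.
Proof.
rewrite /tooth_width ltf_pV2 ?posrE ?mulr_gt0//.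
have n1 : 1 <= n.+1%:R :> R by rewrite ler1n.
have m1 : 1 <= m.+1%:R :> R by rewrite ler1n.
nra.
Qed.

Lemma exists_succ_near {R : realType} (x : R) :
  1 <= x -> exists n : nat, x <= n.+1%:R <= 2 * x.
Proof.
move=> x1; exists (Num.trunc x).
have x0 : 0 <= x by lra.
have /andP[] := truncn_itv x0.
by rewrite -natr1; lra.
Qed.

(** The three ranges of the radius: for r >= 1 the total mass suffices; for
r <= 1/t the density w/(N d) = 16 M w is O(t^(1-a)); in between, the bound
2 r + 2/N is used, where w/N <= t^(-a) <= r^a. *)
Lemma weighted_packet_ball {R : realType} (a b t : R) (n m : nat) :
  0 < a < 1 -> 0 < b -> 1 <= t ->
  t `^ (a - b / 2) <= n.+1%:R ->
  m.+1%:R <= 2 * t `^ (1 - (a - b / 2)) ->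
  forall x r : R, 0 < r ->
  ((t `^ (- (b / 2)))%:E *
    packet n.+1 (tooth_width_gt0 n m) (ball x r : set (measurableTypeR R)) <=
   (64 * r `^ a)%:E)%E.
Proof.
move=> /andP[a0 a1] b0 t1 tN Mt x r r0.
set w := t `^ _.
have t0 : 0 < t by lra.
have tN0 : t != 0 by rewrite gt_eqF.
have w0 : 0 < w by rewrite powR_gt0.
have w1 : w <= 1 by rewrite -(powRr0 t) ler_powR//; lra.
have ra0 : 0 < r `^ a by rewrite powR_gt0.
have mB : measurable (ball x r : set (measurableTypeR R)) by exact: measurable_ball.
have [r1|r1] := leP 1 r.
  apply: (@le_trans _ _ (w%:E * 1)%E).
    by apply: lee_wpmul2l; [rewrite lee_fin ltW|exact: packet_le1].
  have : 1 <= r `^ a by rewrite -(powRr0 r) ler_powR// ltW.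
  by rewrite mule1 lee_fin; lra.
have [tr|tr] := leP (t * r) 1.
  apply: (@le_trans _ _ (w%:E * (2 * r / (n.+1%:R * tooth_width n m))%:E)%E).
    apply: lee_wpmul2l; first by rewrite lee_fin ltW.
    by apply: packet_ball_small => //; exact: tooth_width_lt.
  rewrite -EFinM lee_fin.
  have -> : 2 * r / (n.+1%:R * tooth_width n m) = 32 * r * m.+1%:R.
    have : n.+1%:R != 0 :> R by [].
    have : m.+1%:R != 0 :> R by [].
    rewrite /tooth_width; move: (n.+1%:R) (m.+1%:R) => N M M0 N0.
    by field; rewrite M0.
  have h1 : w * m.+1%:R <= 2 * t `^ (1 - a).
    have -> : 2 * t `^ (1 - a) = w * (2 * t `^ (1 - (a - b / 2))).
      rewrite mulrCA -powRD ?tN0 ?implybT//; congr (_ * _ `^ _); lra.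
    by rewrite ler_pM2l.
  have h2 : r * t `^ (1 - a) <= r `^ a.
    have e : r `^ (1 - a) * r `^ a = r.
      by rewrite -powRD ?(gt_eqF r0) ?implybT// subrK powRr1// ltW.
    rewrite -[X in X * _ <= _]e mulrAC ler_piMl// ?(ltW ra0)//.
    rewrite -powRM ?(ltW r0) ?(ltW t0)// mulrC.
    apply: (@le_trans _ _ (1 `^ (1 - a))); last by rewrite powR1.
    by rewrite ge0_ler_powR ?nnegrE ?mulr_ge0 ?(ltW r0) ?(ltW t0)//; lra.
  have h3 : r * (w * m.+1%:R) <= r * (2 * t `^ (1 - a)) by rewrite ler_pM2l.
  by lra.
apply: (@le_trans _ _ (w%:E * (2 * r + 2 / n.+1%:R)%:E)%E).
  apply: lee_wpmul2l; first by rewrite lee_fin ltW.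
  by apply: packet_ball_large => //; exact: tooth_width_lt.
rewrite -EFinM lee_fin mulrDr.
have h1 : w * (2 * r) <= 2 * r `^ a.
  have : r <= r `^ a by apply: ger1_powR; lra.
  have : w * r <= r by rewrite ler_piMl ?(ltW r0).
  lra.
have h2 : w / n.+1%:R <= r `^ a.
  have h : n.+1%:R^-1 <= t `^ (- (a - b / 2)).
    by rewrite powRN lef_pV2 ?posrE ?powR_gt0.
  apply: (@le_trans _ _ (w * t `^ (- (a - b / 2)))); first by rewrite ler_pM2l.
  rewrite /w -powRD ?tN0 ?implybT// (_ : _ + _ = - a); last by lra.
  rewrite powRN -[X in X <= _]mul1r ler_pdivrMr ?powR_gt0// -powRM ?(ltW r0) ?(ltW t0)//.
  apply: (@le_trans _ _ (1 `^ a)); first by rewrite powR1.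
  by rewrite ge0_ler_powR ?nnegrE ?mulr_ge0 ?(ltW r0) ?(ltW t0) ?(ltW a0)// mulrC ltW.
rewrite [w * (2 / _)]mulrCA; move: (w / _) h2 => q h2.
by lra.
Qed.

(** A factor 1/(1 + d |xi|) is at most its power with exponent b/2 <= 1.  Since
1/d <= 64 t, one has 1 + d |xi| >= (1 + |xi|)/(64 t), and raising this to the
power -b/2 produces the factor t^(b/2) that the weight cancels. *)
Lemma weighted_packet_1Dcos {R : realType} (c b t : R) (n m : nat) :
  0 < b < 1 -> 1 <= t ->
  n.+1%:R <= 2 * t `^ c -> m.+1%:R <= 2 * t `^ (1 - c) ->
  forall xi phi : R,
  ((t `^ (- (b / 2)))%:E * \int[packet n.+1 (tooth_width_gt0 n m)]_x
       (1 + cos (2 * pi * xi * x + phi))%:E <=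
   (t `^ (- (b / 2)) + 128 * (1 + `|xi|) `^ (- (b / 2)))%:E)%E.
Proof.
move=> /andP[b0 b1] t1 Nt Mt xi phi.
set w := t `^ _; set d := tooth_width n m.
have t0 : 0 < t by lra.
have w0 : 0 < w by rewrite powR_gt0.
have d0 : 0 < d := tooth_width_gt0 n m.
have xi0 : 0 <= `|xi| := normr_ge0 xi.
apply: (@le_trans _ _ (w%:E * (1 + 2 / (1 + d * `|xi|))%:E)%E).
  apply: lee_wpmul2l; first by rewrite lee_fin ltW.
  exact: packet_1Dcos_le.
rewrite -EFinM lee_fin mulrDr mulr1 lerD2l.
have D1 : 1 <= 1 + d * `|xi| by rewrite lerDl mulr_ge0// ltW.
have D0 : 0 < 1 + d * `|xi| by lra.
have dt : 1 <= 64 * t * d.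
  rewrite /d /tooth_width ler_pdivlMr ?mulr_gt0// mul1r -mulrA.
  have -> : 64 * t = 16 * ((2 * t `^ c) * (2 * t `^ (1 - c))).
    have -> : 64 * t = 64 * (t `^ c * t `^ (1 - c)).
      by rewrite -powRD ?(gt_eqF t0) ?implybT// addrC subrK powRr1 ?(ltW t0).
    ring.
  by rewrite ler_pM2l// ler_pM.
have step : (1 + d * `|xi|)^-1 <= (64 * t) `^ (b / 2) * (1 + `|xi|) `^ (- (b / 2)).
  apply: (@le_trans _ _ ((1 + d * `|xi|) `^ (- (b / 2)))).
    by rewrite -powR_inv1 ?(ltW D0)// ler_powR//; lra.
  rewrite !powRN -[X in X <= _]mul1r ler_pdivrMr ?powR_gt0//.
  rewrite mulrAC ler_pdivlMr; last by apply: powR_gt0; lra.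
  rewrite mul1r -powRM; [|lra|lra].
  have tD : `|xi| <= 64 * t * d * `|xi| by rewrite ler_peMl.
  by rewrite ge0_ler_powR ?nnegrE//; lra.
have w64 : w * (64 * t) `^ (b / 2) <= 64.
  rewrite powRM// ?(ltW t0)// mulrCA /w -powRD ?(gt_eqF t0) ?implybT// addNr powRr0 mulr1.
  by apply: ler1_powR; lra.
have E0 : 0 < (1 + `|xi|) `^ (- (b / 2)) by apply: powR_gt0; lra.
rewrite mulrCA; set E := (1 + `|xi|) `^ _ in step E0 *.
apply: (@le_trans _ _ (2 * (w * ((64 * t) `^ (b / 2) * E)))).
  by rewrite ler_pM2l// ler_pM2l.
by have := ler_wpM2r (ltW E0) w64; rewrite -mulrA; lra.
Qed.

(** The constants 64 and 128 are absolute, so that these bounds can be summed over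
packets; only the last condition, which measures how strongly the packet violates
the L^p estimate, depends on K. *)
Definition extremal_packet {R : realType} (a b p K : R) (w : {nonneg R})
    (n m : nat) : Prop :=
  [/\ 0 < w%:num <= 1,
      forall x r : R, 0 < r ->
        (w%:num%:E * packet n.+1 (tooth_width_gt0 n m)
           (ball x r : set (measurableTypeR R)) <= (64 * r `^ a)%:E)%E,
      forall xi phi : R,
        (w%:num%:E * \int[packet n.+1 (tooth_width_gt0 n m)]_x
            (1 + cos (2 * pi * xi * x + phi))%:E
         <= (w%:num + 128 * (1 + `|xi|) `^ (- (b / 2)))%:E)%E &
      K <= w%:num * (m.+1%:R / 16) `^ (2 / p)].

(** The condition on p says that e = (1 - c) 2/p - b/2 is positive; then
w (M/16)^(2/p) >= t^e 16^(-2/p) exceeds any K for t large. *)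
Lemma exists_extremal_packet {R : realType} (a b p K : R) :
  0 < a < 1 -> 0 < b < 1 -> b <= 2 * a ->
  2 <= p -> p < (4 - 4 * a + 2 * b) / b ->
  exists q : {nonneg R} * nat * nat, extremal_packet a b p K q.1.1 q.1.2 q.2.
Proof.
move=> a01 b01 ba p2 pp; have /andP[a0 a1] := a01; have /andP[b0 b1] := b01.
have p0 : 0 < p by lra.
pose c := a - b / 2.
have c0 : 0 <= c by rewrite /c; lra.
have c1 : c < 1 by rewrite /c; lra.
pose e := (1 - c) * (2 / p) - b / 2.
have e0 : 0 < e.
  rewrite /e subr_gt0 mulrA ltr_pdivlMr// /c.
  by move: pp; rewrite ltr_pdivlMr//; lra.
(* t is chosen so that t^e = L. *)
pose L := Num.max 1 (K * 16 `^ (2 / p)).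
have L1 : 1 <= L by rewrite le_max lexx.
pose t := L `^ e^-1.
have t1 : 1 <= t.
  by rewrite /t -(powRr0 L) ler_powR// invr_ge0 ltW.
have t0 : 0 < t by lra.
have te : t `^ e = L by rewrite /t -powRrM mulVf ?gt_eqF// powRr1 // (le_trans _ L1).
have tc1 : 1 <= t `^ c by rewrite -(powRr0 t) ler_powR//; lra.
have tc2 : 1 <= t `^ (1 - c) by rewrite -[X in X <= _](powRr0 t) ler_powR// subr_ge0 ltW.
have [n /andP[Nlo Nhi]] := exists_succ_near _ tc1.
have [m /andP[Mlo Mhi]] := exists_succ_near _ tc2.
exists (NngNum (powR_ge0 t (- (b / 2))), n, m); split => /=.
- rewrite powR_gt0//=.
  have : t `^ (- (b / 2)) <= t `^ 0 by rewrite ler_powR//; lra.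
  by rewrite powRr0.
- exact: weighted_packet_ball.
- exact: (weighted_packet_1Dcos c).
- have s0 : 0 <= 2 / p by rewrite divr_ge0 ?(ltW p0).
  apply: (@le_trans _ _ (t `^ (- (b / 2)) * (t `^ (1 - c) / 16) `^ (2 / p))); last first.
    rewrite ler_wpM2l ?powR_ge0// ge0_ler_powR ?s0 ?nnegrE ?divr_ge0 ?powR_ge0//.
    by rewrite ler_pM2r.
  rewrite powRM ?powR_ge0 ?invr_ge0// -powRrM mulrA -powRD; last first.
    by rewrite (gt_eqF t0) implybT.
  rewrite (addrC (- _)) -/e te.
  have -> : (16^-1 : R) `^ (2 / p) = (16 `^ (2 / p))^-1.
    by rewrite -(@powR_inv1 R 16)// -powRrM mulN1r powRN.
  rewrite ler_pdivlMr; last exact: powR_gt0.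
  by rewrite le_max lexx orbT.
Qed.

(** * Dyadic mixtures and normalisation *)

Lemma sum_dyadic {R : realType} (B : R) :
  (\sum_(0 <= k <oo) (2^-1 ^+ k.+1 * B)%:E = B%:E)%E.
Proof.
have := @cvg_geometric_eseries_half R B 0.
rewrite expr0 divr1 => /(cvg_lim (@ereal_hausdorff R)) <-.
congr (limn (eseries _)); apply/funext => k.
by rewrite addn1 natrX exprVn mulrC.
Qed.

Definition dyadic_weight {R : realType} (w : nat -> {nonneg R}) (k : nat) :
    {nonneg R} := (2^-1 ^+ k.+1 * (w k)%:num)%:nng.

Definition dyadic_mixture {R : realType} (w : nat -> {nonneg R})
    (P : nat -> {measure set (measurableTypeR R) -> \bar R}) :
    {measure set (measurableTypeR R) -> \bar R} :=
  mseries (fun k => mscale (dyadic_weight w k) (P k)) 0.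

Lemma dyadic_mixture_le {R : realType} (w : nat -> {nonneg R})
    (P : nat -> {measure set (measurableTypeR R) -> \bar R})
    (A : set (measurableTypeR R)) (B : R) :
  (forall k, ((w k)%:num%:E * P k A <= B%:E)%E) ->
  (dyadic_mixture w P A <= B%:E)%E.
Proof.
move=> PB; rewrite -[leRHS]sum_dyadic; apply: lee_nneseries => [k _ _|k _].
  exact: measure_ge0.
rewrite /= /mscale/= EFinM -muleA EFinM.
by apply: lee_wpmul2l; rewrite // lee_fin exprn_ge0.
Qed.

Lemma dyadic_mixture_ge {R : realType} (w : nat -> {nonneg R})
    (P : nat -> {measure set (measurableTypeR R) -> \bar R})
    (A : set (measurableTypeR R)) (k : nat) :
  ((2^-1 ^+ k.+1 * (w k)%:num)%:E * P k A <= dyadic_mixture w P A)%E.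
Proof.
apply: (@le_trans _ _ (\sum_(0 <= i < k.+1)
  mscale (dyadic_weight w i) (P i) A)%E).
  by rewrite big_nat_recr//= leeDr// sume_ge0.
exact: nneseries_lim_ge.
Qed.

Lemma integral_dyadic_mixture_le {R : realType} (w : nat -> {nonneg R})
    (P : nat -> {measure set (measurableTypeR R) -> \bar R})
    (f : measurableTypeR R -> \bar R) (B : R) :
  measurable_fun setT f -> (forall x, 0 <= f x)%E -> 0 <= B ->
  (forall k, ((w k)%:num%:E * \int[P k]_x f x <=
              (w k)%:num%:E * P k setT + B%:E)%E) ->
  (\int[dyadic_mixture w P]_x f x <= dyadic_mixture w P setT + B%:E)%E.
Proof.
move=> mf f0 B0 fB; rewrite ge0_integral_measure_series//.
rewrite -[X in (_ + X)%E]sum_dyadic /= -nneseriesD//; last first.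
  by move=> k _ _; rewrite lee_fin mulr_ge0// exprn_ge0.
apply: lee_nneseries => [k _ _|k _]; first exact: integral_ge0.
rewrite ge0_integral_mscale//= /mscale/= 2!EFinM -!muleA -muleDr//.
  by apply: lee_wpmul2l; rewrite // lee_fin exprn_ge0.
by rewrite ge0_adde_def// inE ?mule_ge0// lee_fin.
Qed.

Lemma normalize_measure {R : realType}
    (m : {measure set (measurableTypeR R) -> \bar R}) (s : R) :
  0 < s -> m setT = s%:E ->
  exists mu : probability (measurableTypeR R) R,
    forall A, mu A = ((s^-1)%:E * m A)%E.
Proof.
move=> s0 ms; exists (mnormalize m (dirac (0 : measurableTypeR R))) => A.
rewrite /= /mnormalize ms.
by rewrite eqe (gt_eqF s0)/= muleC.
Qed.

Lemma ge0_integral_proportional {R : realType}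
    (m mu : {measure set (measurableTypeR R) -> \bar R}) (c : {nonneg R})
    (f : measurableTypeR R -> \bar R) :
  (forall A, mu A = (c%:num%:E * m A)%E) ->
  measurable_fun setT f -> (forall x, 0 <= f x)%E ->
  (\int[mu]_x f x = c%:num%:E * \int[m]_x f x)%E.
Proof.
move=> muE mf f0; rewrite -ge0_integral_mscale//.
by apply: eq_measure_integral => A mA _; rewrite muE.
Qed.

(** * The Knapp-type obstruction *)

Lemma cos_ge_cos1 {R : realType} (y : R) : 0 <= y < 1 -> cos 1 <= cos y.
Proof.
move=> /andP[y0 y1]; have := pi_ge2 R => pi2.
by apply: ltW; rewrite ltr_cos// in_itv/=; apply/andP; split; lra.
Qed.

(** Write x = j/N + u and xi = l N + v with 0 <= u <= d and 0 <= v <= 1/16.  Then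
x xi = j l + (j/N) v + u xi, where j l is an integer and each of the other two
terms lies in [0, 1/16], because xi <= N M and d N M = 1/16.  As pi < 4, the
phase is congruent to a number in [0, 1). *)
Lemma grid_phase {R : realType} (n m : nat) (x xi : R) :
  grid n.+1%:R^-1 (tooth_width n m) n.+1 x -> grid n.+1%:R 16^-1 m.+1 xi ->
  cos 1 <= cos (2 * pi * x * xi).
Proof.
rewrite /grid -!bigcup_mkord => -[j/= jn] + [l/= lm].
rewrite /grid_itv/= !in_itv/= /tooth_width.
have N0 : 0 < n.+1%:R :> R by [].
have M0 : 0 < m.+1%:R :> R by [].
have N1 : 1 <= n.+1%:R :> R by rewrite ler1n.
have : j%:R <= n.+1%:R :> R by rewrite ler_nat ltnW.
have : l.+1%:R <= m.+1%:R :> R by rewrite ler_nat.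
have l0 : 0 <= l%:R :> R by [].
have j0 : 0 <= j%:R :> R by [].
move: (@cosD2pi R) => /periodicn/(_ (j * l)%N).
rewrite -[l.+1%:R]natr1 -[(pi *+ 2) *+ _]mulr_natr natrM -[pi *+ 2]mulr_natl.
move: (j%:R) (l%:R) (n.+1%:R) (m.+1%:R) N0 N1 M0 l0 j0
  => J L N M N0 N1 M0 L0 J0 per LM JN.
set d := (16 * N * M)^-1 => /andP[xlo xhi] /andP[xilo xihi].
pose u := x - J / N; pose v := xi - L * N.
have xE : x = J / N + u by rewrite /u addrC subrK.
have xiE : xi = L * N + v by rewrite /v addrC subrK.
have -> : 2 * pi * x * xi =
          2 * pi * (J / N * v + u * xi) + 2 * pi * (J * L).
  by rewrite xE xiE; field; rewrite gt_eqF.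
rewrite per; apply: cos_ge_cos1.
have u0 : 0 <= u by rewrite subr_ge0.
have v0 : 0 <= v by rewrite subr_ge0.
have v16 : v <= 16^-1 by rewrite /v lerBlDl.
have ud : u <= d by rewrite /u lerBlDl.
have JN0 : 0 <= J / N by rewrite divr_ge0// ltW.
have JN1 : J / N <= 1 by rewrite ler_pdivrMr// mul1r.
have xi0 : 0 <= xi by rewrite (le_trans _ xilo)// mulr_ge0// ltW.
have xiNM : xi <= N * M.
  apply: (le_trans xihi); apply: (@le_trans _ _ ((L + 1) * N)).
    by rewrite mulrDl mul1r lerD2l (le_trans _ N1)// invf_le1// ler1n.
  by rewrite mulrC ler_pM2l.
have dNM : d * (N * M) = 16^-1.
  by rewrite /d; field; rewrite !gt_eqF.
have h1 : J / N * v <= 16^-1 by rewrite (le_trans _ v16)// ler_piMl.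
have h2 : u * xi <= 16^-1.
  by rewrite -dNM; apply: ler_pM.
have h3 : 0 <= J / N * v by rewrite mulr_ge0.
have h4 : 0 <= u * xi by rewrite mulr_ge0.
have := pihalf_lt2 R; have := pi_gt0 R => pi0 pi4.
apply/andP; split; first by rewrite mulr_ge0 ?(addr_ge0 h3) ?mulr_ge0 ?(ltW pi0).
apply: (@le_lt_trans _ _ (2 * pi * 8^-1)); last by lra.
rewrite ler_pM2l; first by lra.
by rewrite mulr_gt0.
Qed.

(** The integral of a nonnegative function, measurable or not, is a supremum over
the simple functions below it; c times the indicator of G is one of them.  This
form applies directly to the modulus of a Fourier transform as a function of the
frequency. *)
Lemma integral_ge_cst_on {R : realType}
    (mu : {measure set (measurableTypeR R) -> \bar R})
    (G : set (measurableTypeR R)) (c : R) (f : measurableTypeR R -> \bar R) :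
  measurable G -> 0 <= c -> (forall x, 0 <= f x)%E ->
  (forall x, G x -> (c%:E <= f x)%E) ->
  (c%:E * mu G <= \int[mu]_x f x)%E.
Proof.
move=> mG c0 f0 cf.
rewrite -integral_cst// integral_mkcond.
rewrite !ge0_integralTE//; last first.
  by move=> x; rewrite patchE; case: ifP => // _; rewrite lee_fin.
apply: ereal_sup_le => _ [h hle <-]; exists h => // x.
apply: (le_trans (hle x)); rewrite patchE; case: ifP => // xG.
by apply: cf; rewrite inE in xG.
Qed.

Definition cindic {R : realType} (S : set (measurableTypeR R)) :
  measurableTypeR R -> R[i] := fun x => Complex (\1_S x) 0.

Lemma cmod_cindic {R : realType} (S : set (measurableTypeR R)) x :
  cmod (cindic S x) = \1_S x.
Proof.
by rewrite /cmod /cindic /= expr0n addr0 sqrtr_sqr ger0_norm// indicE ler0n.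
Qed.

Lemma cLnorm_cindic {R : realType}
    (mu : {measure set (measurableTypeR R) -> \bar R})
    (S : set (measurableTypeR R)) : measurable S ->
  cLnorm mu 2 (cindic S) = (mu S `^ 2^-1)%E.
Proof.
move=> mS; rewrite /cLnorm unlock; congr (_ `^ _)%E.
have -> : mu S = (\int[mu]_x (\1_S x)%:E)%E by rewrite integral_indic// setIT.
apply: eq_integral => x _; rewrite compE cmod_cindic indicE; case: (x \in S).
  by rewrite abse1 poweR1r.
by rewrite abse0 poweR0r.
Qed.

Lemma cLfun_cindic {R : realType} (mu : probability (measurableTypeR R) R)
    (S : set (measurableTypeR R)) : measurable S ->
  cLfun mu 2 (cindic S).
Proof.
move=> mS; split.
  by split => /=; [exact: measurable_indic|exact: measurable_cst].
rewrite cLnorm_cindic//; apply: poweR_lty.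
by rewrite (le_lt_trans (probability_le1 mu mS))// ltry.
Qed.

Lemma Re_le_cmod {R : realType} (z : R[i]) : `|complex.Re z| <= cmod z.
Proof.
case: z => u v; rewrite /cmod /= -sqrtr_sqr.
by apply: ler_wsqrtr; rewrite lerDl sqr_ge0.
Qed.

Lemma cmod_le {R : realType} (z : R[i]) :
  cmod z <= `|complex.Re z| + `|complex.Im z|.
Proof.
case: z => u v; rewrite /cmod /=.
rewrite -[leRHS]ger0_norm ?addr_ge0// -sqrtr_sqr.
apply: ler_wsqrtr; rewrite sqrrD !real_normK ?num_real//.
by rewrite -addrA lerD2l lerDr mulrn_wge0// mulr_ge0.
Qed.

Lemma integrable_le1 {R : realType} (mu : probability (measurableTypeR R) R)
    (h : measurableTypeR R -> R) :
  measurable_fun setT h -> (forall x, `|h x| <= 1) ->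
  mu.-integrable setT (EFin \o h).
Proof.
move=> mh h1; apply: measurable_bounded_integrable => //.
  by rewrite (le_lt_trans (probability_le1 mu measurableT))// ltry.
exists 1; split; rewrite ?num_real// => y y1 x _ /=.
by rewrite (le_trans (h1 x))// ltW.
Qed.

(** By the choice of teeth and frequencies there is no cancellation in the real
part. *)
Lemma fourier_cindic_ge {R : realType} (mu : probability (measurableTypeR R) R)
    (n m : nat) (S := grid n.+1%:R^-1 (tooth_width n m) n.+1) (xi : R) :
  grid n.+1%:R 16^-1 m.+1 xi ->
  cos 1 * fine (mu S) <= cmod (fourier_density mu (cindic S) xi).
Proof.
move=> Gxi; apply: le_trans (Re_le_cmod _); apply: le_trans (ler_norm _).
have mS : measurable S by exact: measurable_grid.
rewrite /fourier_density /cintegral /=.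
have fin1 : (mu setT < +oo)%E.
  by rewrite (le_lt_trans (probability_le1 mu measurableT))// ltry.
have -> : cos 1 * fine (mu S) = \int[mu]_x (cos 1 * \1_S x).
  rewrite RintegralZl//; last first.
    by apply: integrable_le1 => // x; rewrite ger0_norm// indicE; case: (x \in S).
  by rewrite /Rintegral integral_indic// setIT.
apply: le_Rintegral => //.
- apply: integrable_le1; first exact: measurable_funM.
  move=> x; rewrite normrM indicE.
  by case: (x \in S); rewrite ?normr1 ?normr0 ?mulr1 ?mulr0// cos_max.
- under eq_fun do rewrite mulr0 subr0.
  apply: integrable_le1.
    apply: measurable_funM => //; apply: measurable_cos.
    by apply: measurableT_comp => //; do 2 apply: measurable_funM => //.
  move=> x; rewrite normrM indicE.
  by case: (x \in S); rewrite ?normr1 ?normr0 ?mulr1 ?mulr0// cos_max.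
- move=> x _; rewrite mulr0 subr0 indicE.
  have [xS|xS] := boolP (x \in S); rewrite ?mulr1 ?mulr0// cosN.
  by apply: grid_phase Gxi; rewrite inE in xS.
Qed.

(** Both sides of the estimate are raised to the power p to integrate, then to the
power 2/p; the squared L^2 norm of the indicator is mu(S), which cancels one of
the two factors mu(S) on the left. *)
Lemma knapp_lower_bound {R : realType} (mu : probability (measurableTypeR R) R)
    (n m : nat) (S := grid n.+1%:R^-1 (tooth_width n m) n.+1) (p C : R) :
  0 < p -> 0 < C -> (0 < mu S)%E ->
  (cLnorm (@lebesgue_measure R) p (fourier_density mu (cindic S))
     <= C%:E * cLnorm mu 2 (cindic S))%E ->
  cos 1 ^+ 2 * fine (mu S) * (m.+1%:R / 16) `^ (2 / p) <= C ^+ 2.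
Proof.
move=> p0 C0 muS H.
have mS : measurable S by exact: measurable_grid.
pose s := fine (mu S).
have muSE : mu S = s%:E.
  by rewrite /s fineK// ge0_fin_numE// (le_lt_trans (probability_le1 mu mS))// ltry.
have s0 : 0 < s by rewrite -lte_fin -muSE.
have c0 : 0 < cos 1 :> R := cos1_gt0 R.
have NE : cLnorm mu 2 (cindic S) = (s `^ 2^-1)%:E.
  by rewrite cLnorm_cindic// -poweR_EFin -muSE.
rewrite NE -EFinM in H.
have cs0 : 0 <= cos 1 * s by rewrite mulr_ge0// ltW.
have Cs0 : 0 <= C * s `^ 2^-1 by rewrite mulr_ge0 ?powR_ge0// ltW.
have low : (((cos 1 * s) `^ p)%:E * (m.+1%:R / 16)%:E <=
            ((C * s `^ 2^-1) `^ p)%:E)%E.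
  apply: (@le_trans _ _ (cLnorm (@lebesgue_measure R) p
    (fourier_density mu (cindic S)) `^ p)%E); last first.
    rewrite -poweR_EFin; apply: gt0_ler_poweR; rewrite ?(ltW p0)// in_itv/= leey andbT.
      exact: Lnorm_ge0.
    by rewrite lee_fin.
  rewrite /cLnorm poweR_Lnorm ?gt_eqF//.
  rewrite -(@lebesgue_measure_grid R n.+1%:R 16^-1) ?invr_gt0//; last first.
    have : 1 <= n.+1%:R :> R by rewrite ler1n.
    by apply: lt_le_trans; rewrite invf_lt1// ltr1n.
  apply: integral_ge_cst_on => //.
  - exact: measurable_grid.
  - exact: powR_ge0.
  - by move=> x; exact: poweR_ge0.
  - move=> xi Gxi; rewrite -poweR_EFin.
    apply: gt0_ler_poweR; rewrite ?(ltW p0)// ?in_itv/= ?leey ?lee_fin ?andbT//.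
    by rewrite (le_trans (fourier_cindic_ge _ _ _ _ Gxi))// ler_norm.
rewrite -EFinM lee_fin in low.
have M0 : 0 <= m.+1%:R / 16 :> R by rewrite divr_ge0.
have sq (y : R) : 0 <= y -> (y `^ p) `^ (2 / p) = y ^+ 2.
  by move=> y0; rewrite -powRrM mulrC divfK ?gt_eqF// -powR_mulrn.
have : ((cos 1 * s) `^ p * (m.+1%:R / 16)) `^ (2 / p) <=
       ((C * s `^ 2^-1) `^ p) `^ (2 / p).
  have p20 : 0 <= 2 / p by rewrite divr_ge0 ?(ltW p0).
  by rewrite (ge0_ler_powR p20)// nnegrE ?mulr_ge0 ?powR_ge0.
rewrite powRM ?powR_ge0// !sq// powR12_sqrt ?(ltW s0)//.
rewrite [(C * _) ^+ 2]exprMn sqr_sqrtr ?(ltW s0)//.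
move=> h; rewrite -/s -(ler_pM2r s0); apply: le_trans h.
by rewrite exprMn [s ^+ 2]expr2; lra.
Qed.

(** * From the nonnegative form of decay to the Fourier transform *)

(** Subtracting the total mass 1 leaves a one-sided bound on the integral of every
shifted cosine; shifting phi by pi changes the sign, so the bound is two-sided. *)
Lemma cmod_fourier_le {R : realType} (mu : probability (measurableTypeR R) R)
    (xi E : R) :
  (forall phi : R,
    (\int[mu]_x (1 + cos (2 * pi * xi * x + phi))%:E <= (1 + E)%:E)%E) ->
  cmod (fourier mu xi) <= 2 * E.
Proof.
move=> H.
have ic phi : mu.-integrable setT
    (EFin \o (fun x : R => cos (2 * pi * xi * x + phi))).
  apply: integrable_le1 => [|x]; last exact: cos_max.
  apply: measurable_cos.
  by apply: measurable_funD => //; exact: measurable_funM.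
have osc phi : \int[mu]_x cos (2 * pi * xi * x + phi) <= E.
  have i1 : mu.-integrable setT (EFin \o cst (1 : R)).
    by apply: integrable_le1 => // x; rewrite normr1.
  have : \int[mu]_x (1 + cos (2 * pi * xi * x + phi)) <= 1 + E.
    rewrite -lee_fin (le_trans _ (H phi))// /Rintegral fineK//.
    apply: integrable_fin_num => //; exact: (integrableD measurableT i1 (ic phi)).
  rewrite (RintegralD measurableT i1 (ic phi)) Rintegral_cst//.
  by rewrite mul1r [X in fine X](probability_setT mu) lerD2l.
rewrite (le_trans (cmod_le _))// (_ : 2 * E = E + E); last by ring.
have neg phi : - (\int[mu]_x cos (2 * pi * xi * x + phi)) <= E.
  have -> : - (\int[mu]_x cos (2 * pi * xi * x + phi)) =
      \int[mu]_x (-1 * cos (2 * pi * xi * x + phi)).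
    by rewrite (RintegralZl (-1) measurableT (ic phi)) mulN1r.
  apply: le_trans (osc (phi + pi)).
  rewrite le_eqVlt; apply/predU1P; left; apply: eq_Rintegral => x _.
  by rewrite addrA cosDpi mulN1r.
rewrite lerD//= ler_norml lerNl.
- rewrite (_ : \int[mu]_x _ = \int[mu]_x cos (2 * pi * xi * x + 0)).
    by rewrite osc neg.
  by apply: eq_Rintegral => x _; rewrite cosN addr0; congr cos; ring.
- rewrite (_ : \int[mu]_x _ = \int[mu]_x cos (2 * pi * xi * x + pi / 2)).
    by rewrite osc neg.
  by apply: eq_Rintegral => x _; rewrite sinN cosDpihalf; congr (- sin _); ring.
Qed.

(** * The theorem *)

Theorem mainTheorem3 (R : realType) (a b : R)
    (ha : 0 < a < 1) (hb : 0 < b < 1) (hab : b <= 2 * a) :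
  forall p0 : R, p0 < (4 - 4 * a + 2 * b) / b ->
  exists (mu : probability (measurableTypeR R) R) (p : R),
    [/\ 1 <= p, p0 <= p,
        (exists2 C : R, 0 < C &
           forall x r : R, 0 < r ->
             (mu (ball x r : set (measurableTypeR R)) <= (C * r `^ a)%:E)%E),
        (exists2 C : R, 0 < C &
           forall xi : R,
             cmod (fourier mu xi) <= C * (1 + `|xi|) `^ (- (b / 2))) &
        ~ (exists2 C : R, 0 < C &
             forall f : measurableTypeR R -> R[i], cLfun mu 2 f ->
               (cLnorm (@lebesgue_measure R) p (fourier_density mu f)
                  <= C%:E * cLnorm mu 2 f)%E)].
Proof.
(* The estimate is refuted at the smallest exponent allowed, raised to 2 when
   p0 < 2; the critical exponent exceeds 2 because 4 - 4 a > 0. *)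
move=> p0 p0lt; pose p := Num.max p0 2.
have p2 : 2 <= p by rewrite le_max lexx orbT.
have pp : p < (4 - 4 * a + 2 * b) / b.
  have /andP[a0 a1] := ha; have /andP[b0 b1] := hb.
  by rewrite gt_max p0lt/= ltr_pdivlMr//; lra.
(* The factor 2^(k+1) compensates the weight of the k-th packet in the mixture. *)
have [q qP] := choice (fun k : nat =>
  exists_extremal_packet a b p (2 ^+ k.+1 * k.+1%:R) ha hb hab p2 pp).
pose w k := (q k).1.1; pose n k := (q k).1.2; pose m k := (q k).2.
pose P k : {measure set (measurableTypeR R) -> \bar R} :=
  packet (n k).+1 (tooth_width_gt0 (n k) (m k)).
pose S k : set (measurableTypeR R) :=
  grid (n k).+1%:R^-1 (tooth_width (n k) (m k)) (n k).+1.
have mS k : measurable (S k) by exact: measurable_grid.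
have PS k : P k (S k) = 1%E by exact: packet_grid.
have PT k : P k setT = 1%E.
  by apply/eqP; rewrite eq_le packet_le1//= -(PS k) le_measure// ?inE.
pose mu0 := dyadic_mixture w P.
have mu0_le1 : (mu0 setT <= 1)%E.
  apply: dyadic_mixture_le => k; have [/andP[_ w1] _ _ _] := qP k.
  by rewrite PT mule1 lee_fin.
have mu0S k : ((2^-1 ^+ k.+1 * (w k)%:num)%:E <= mu0 (S k))%E.
  by rewrite -[leLHS]mule1 -(PS k) dyadic_mixture_ge.
pose s := fine (mu0 setT).
have sE : mu0 setT = s%:E.
  by rewrite /s fineK// ge0_fin_numE// (le_lt_trans mu0_le1)// ltry.
have s1 : s <= 1 by rewrite -lee_fin -sE.
have s0 : 0 < s.
  have [/andP[w0 _] _ _ _] := qP 0%N.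
  rewrite -lte_fin -sE (lt_le_trans _ (le_trans (mu0S 0%N) _))//.
    by rewrite lte_fin mulr_gt0// exprn_gt0.
  by rewrite le_measure// ?inE.
have sN0 : s != 0 by rewrite gt_eqF.
have [mu muE] := normalize_measure mu0 s s0 sE.
have V0 : 0 < s^-1 by rewrite invr_gt0.
exists mu, p; split.
- by lra.
- by rewrite le_max lexx.
- exists (s^-1 * 64); first by rewrite mulr_gt0.
  move=> x r r0; rewrite muE -mulrA EFinM; apply: lee_wpmul2l.
    by rewrite lee_fin ltW.
  by apply: dyadic_mixture_le => k; have [_ + _ _] := qP k; apply.
- exists (2 * (s^-1 * 128)); first by rewrite !mulr_gt0.
  move=> xi; rewrite -!mulrA; apply: cmod_fourier_le => phi.
  have f0 (x : R) : (0 <= (1 + cos (2 * pi * xi * x + phi))%:E)%E.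
    by rewrite lee_fin -lerBlDl sub0r cos_geN1.
  rewrite (@ge0_integral_proportional R mu0 mu (NngNum (ltW V0)))//; last first.
    exact: measurable_1Dcos.
  rewrite -[X in (_ <= (X + _)%:E)%E](mulVf sN0) -mulrDr EFinM.
  apply: lee_wpmul2l; first by rewrite lee_fin ltW.
  rewrite EFinD -sE; apply: integral_dyadic_mixture_le => //.
  + exact: measurable_1Dcos.
  + by move=> k; rewrite PT mule1 -EFinD; have [_ _ + _] := qP k; apply.
- move=> [C C0 ext].
  have c0 : 0 < cos 1 :> R := cos1_gt0 R.
  have bound k : cos 1 ^+ 2 * k.+1%:R <= C ^+ 2.
    have [/andP[w0 _] _ _ big] := qP k.
    (* Normalising divides by a total mass s <= 1, which only enlarges mu. *)
    have muS : ((2^-1 ^+ k.+1 * (w k)%:num)%:E <= mu (S k))%E.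
      rewrite (le_trans (mu0S k))// muE -[leLHS]mul1e lee_wpmul2r//.
      by rewrite lee_fin invf_ge1.
    have muS0 : (0 < mu (S k))%E.
      by apply: lt_le_trans muS; rewrite lte_fin mulr_gt0// exprn_gt0.
    have p_gt0 : 0 < p by lra.
    have := knapp_lower_bound mu _ _ _ C p_gt0 C0 muS0 (ext _ (cLfun_cindic _ _ (mS k))).
    apply: le_trans; rewrite -mulrA ler_wpM2l ?sqr_ge0//.
    apply: (@le_trans _ _ ((2^-1 ^+ k.+1 * (w k)%:num) *
        ((m k).+1%:R / 16) `^ (2 / p))).
      rewrite -mulrA -(ler_pM2l (exprn_gt0 k.+1 (ltr0n R 2))).
      by rewrite [leRHS]mulrA -exprMn divff ?expr1n ?mul1r.
    rewrite ler_wpM2r ?powR_ge0// -lee_fin fineK//.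
    by rewrite ge0_fin_numE// (le_lt_trans (probability_le1 mu (mS k)))// ltry.
  have c2 : 0 < cos 1 ^+ 2 :> R by rewrite exprn_gt0.
  have := bound (Num.trunc (C ^+ 2 / cos 1 ^+ 2)).
  rewrite mulrC -ler_pdivlMr// leNgt => /negP; apply.
  have /andP[] := truncn_itv (divr_ge0 (sqr_ge0 C) (ltW c2)).
  by [].
Qed.
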